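(* Let $G$ be a finite group. If $\alpha(G)\ge\frac{3}{4}$, then $\beta(G)\ge\frac{2}{3}$. Moreover, if $\alpha(G)\ge\frac{5}{6}$, then $\beta(G)\in\left\{\frac{4}{5},\frac{6}{7},1\right\}$.
   Context: For a finite group $G$ with identity $e$, $c(G)$ is the number of cyclic subgroups of $G$ (including the trivial subgroup), $i(G)=|\{x\in G: x^2=e\}|$ (so the identity is counted), $\alpha(G)=\frac{c(G)}{|G|}$, and $\beta(G)=\frac{i(G)}{c(G)}$. *)

(* Defs.v *)
From mathcomp Require Import all_boot all_order all_algebra all_fingroup all_solvable.

Set Implicit Arguments.
Unset Strict Implicit.
Unset Printing Implicit Defensive.

Section CyclicSubgroupRatios.

Variables (gT : finGroupType) (G : {group gT}).

Definition num_cyclic : nat := #|[set H in subgroups G | cyclic H]|.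

Definition num_sqr1 : nat := #|[set x in G | (x ^+ 2 == 1)%g]|.

Definition alpha : rat := (num_cyclic%:R / #|G|%:R)%R.

Definition beta : rat := (num_sqr1%:R / num_cyclic%:R)%R.

End CyclicSubgroupRatios.

(* Main.v *)
Require Import Defs.
From mathcomp Require Import all_boot all_order all_algebra all_fingroup all_solvable.
From mathcomp Require Import zify.

(** Sorting the elements of [G] by the cyclic subgroup they generate gives
    [2 c(G) <= |G| + i(G)], since only the subgroups of order at most 2 have a
    single generator, with equality in exponent dividing 4. This yields the first bound,
    and [i(G) >= 2|G|/3] under the second hypothesis. Let [I] be the set of
    solutions of [x^2 = 1]. For [x] in [I], the intersection of [I] and [x I]
    consists of the elements of [I] commuting with [x], so the centraliser of
    [x] has at least [2 |I| - |G| >= |G|/3] elements. If all these centralisers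
    are [G], then [I = G]. Index 3 forces [i(G) = 2|G|/3]. If some [C = C_G(x)]
    has index 2, at most half of [G \ C] lies in [I], so [I] fills at least 5/6
    of [C] and [C] has exponent 2; then [i(G) = |C| + |C_C(y)|] for any [y] in
    [I \ C], which leaves only [i(G) = 3|G|/4] or [2|G|/3]. *)

Set Implicit Arguments.
Unset Strict Implicit.
Unset Printing Implicit Defensive.

Import Order.TTheory GRing.Theory Num.Theory.
Local Open Scope ring_scope.

Section SquareRootsOfOne.

Local Open Scope nat_scope.
Local Open Scope group_scope.

Variable gT : finGroupType.
Implicit Types (G H : {group gT}) (A : {set gT}).

(* The cardinal of a group and of a set of group elements go through different,
   convertible, [finType] structures, which [lia] would see as distinct atoms. *)
Ltac card_lia := simpl gval in *;
  change (fingroup_FinStarMonoid__to__fintype_Finite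
    (fingroup_FinGroup__to__fingroup_FinStarMonoid gT))
  with (fingroup_FinGroup__to__fintype_Finite gT) in *; lia.

Definition sqr1 A := [set x in A | x ^+ 2 == 1].

Lemma sqr1V A x : x \in sqr1 A -> x^-1 = x.
Proof.
rewrite inE => /andP[_ /eqP x2].
by apply: (mulgI x); rewrite mulgV -x2 expgS expg1.
Qed.

(** Both factors are their own inverses, so [(x * y)^-1 = y * x]. *)
Lemma sqr1M A x y : x \in sqr1 A -> y ^+ 2 == 1 ->
  ((x * y) ^+ 2 == 1) = (y \in 'C[x]).
Proof.
move=> Ix y2; have xV := sqr1V Ix.
have yV : y^-1 = y by apply: (@sqr1V setT); rewrite inE y2 inE.
rewrite cent1E expgS expg1 -eq_invg_mul invMg xV yV; exact/eqP/eqP.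
Qed.

(** Inclusion-exclusion for [sqr1 A] and its translate by [x], both inside [A]. Only invariance of
    [A] is asked, so that [A] can also be the complement of a centraliser. *)
Lemma card_sqr1_cent1 A G x : x \in sqr1 G -> x *: A = A ->
  (2 * #|sqr1 A| <= #|A| + #|sqr1 A :&: 'C[x]|)%N.
Proof.
move=> Ix xA; have xV := sqr1V Ix.
have sI : sqr1 A \subset A by apply/subsetP=> y; rewrite inE => /andP[].
have sU : sqr1 A :|: x *: sqr1 A \subset A.
  by rewrite subUset sI -{2}xA mulgS.
have -> : sqr1 A :&: 'C[x] = sqr1 A :&: x *: sqr1 A.
  apply/setP=> y; rewrite !in_setI; apply: andb_id2l => Iy.
  have /andP[Ay y2] : (y \in A) && (y ^+ 2 == 1) by rewrite inE in Iy.
  have Axy : x * y \in A by rewrite -xA mem_lcoset mulKg.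
  by rewrite mem_lcoset xV [RHS]inE Axy (sqr1M Ix y2).
have := cardsUI (sqr1 A) (x *: sqr1 A).
have := subset_leq_card sU.
rewrite card_lcoset; lia.
Qed.

Lemma index_mul_bound G H k : H \subset G -> (#|G| < k * #|H|)%N ->
  (#|G : H| < k)%N.
Proof. by move=> /Lagrange <-; rewrite mulnC ltn_pmul2r ?cardG_gt0. Qed.

(** Products of commuting solutions are solutions, so [sqr1 G] is a subgroup, of index below 2. *)
Lemma sqr1_central G : sqr1 G \subset 'C(G) -> (#|G| < 2 * #|sqr1 G|)%N ->
  sqr1 G = G.
Proof.
move=> cI ltI; have sI : sqr1 G \subset G by apply/subsetP=> y /setIdP[].
have gI : group_set (sqr1 G).
  apply/group_setP; split=> [|x y Ix Iy]; first by rewrite inE group1 expg1n eqxx.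
  have /setIdP[Gy y2] := Iy.
  rewrite inE groupM ?(subsetP sI x Ix) // (sqr1M Ix y2).
  by rewrite cent1C; apply/cent1P/(centP (subsetP cI x Ix)).
have := @index_mul_bound G (Group gI) 2 sI ltI.
rewrite ltnS => le1; apply/eqP; rewrite eqEsubset sI.
rewrite -[sqr1 G]/(gval (Group gI)) -indexg_eq1 eqn_leq le1.
exact: indexg_gt0.
Qed.

(** The centraliser of a solution has at least [2 * #|sqr1 G| - #|G|] elements, more than half of
    [G], so solutions are central. *)
Lemma sqr1_large G : (3 * #|G| < 4 * #|sqr1 G|)%N -> sqr1 G = G.
Proof.
move=> ltI; apply: sqr1_central; last card_lia.
apply/subsetP=> x Ix; have /setIdP[Gx _] := Ix.
have := card_sqr1_cent1 Ix (lcoset_id Gx).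
have sIC : sqr1 G :&: 'C[x] \subset 'C_G[x].
  by apply: setSI; apply/subsetP=> y /setIdP[].
have := subset_leq_card sIC => le1 le2.
have le3 : (#|G : 'C_G[x]| < 2)%N.
  by apply: index_mul_bound (subsetIl _ _) _; card_lia.
have : #|G : 'C_G[x]| == 1%N by rewrite eqn_leq -ltnS le3 indexg_gt0.
by rewrite indexg_eq1 subsetI subxx sub_cent1.
Qed.

Lemma sqr1_two_thirds G : (2 * #|G| <= 3 * #|sqr1 G|)%N ->
  [\/ sqr1 G = G, (3 * #|sqr1 G| = 2 * #|G|)%N
    | (4 * #|sqr1 G| = 3 * #|G|)%N /\ {in G, forall x, x ^+ 4 = 1}].
Proof.
move=> leI; have nG := cardG_gt0 G.
have [cI|] := boolP (sqr1 G \subset 'C(G)).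
  by constructor 1; apply: sqr1_central => //; card_lia.
case/subsetPn=> x Ix ncx; have /setIdP[Gx x2] := Ix.
have sC : 'C_G[x] \subset G := subsetIl _ _.
have sIC : sqr1 G :&: 'C[x] \subset 'C_G[x].
  by apply: setSI; apply/subsetP=> y /setIdP[].
have leC := subset_leq_card sIC.
have leIC := card_sqr1_cent1 Ix (lcoset_id Gx).
have LC := Lagrange sC.
have nC := cardG_gt0 'C_G[x].
have iC1 : #|G : 'C_G[x]| != 1%N.
  by rewrite indexg_eq1 subsetI subxx sub_cent1.
have iC0 := indexg_gt0 G 'C_G[x].
have iC4 : (#|G : 'C_G[x]| < 4)%N by apply: index_mul_bound => //; card_lia.
have [iC|iC3] : #|G : 'C_G[x]| = 2 \/ #|G : 'C_G[x]| = 3.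
- by card_lia.
(* Index 3 in [leIC] gives the reverse of [leI]. *)
- 2: by constructor 2; rewrite iC3 in LC; card_lia.
rewrite iC in LC; clear iC0 iC1 iC4.
have Cx : x \in 'C_G[x] by rewrite inE Gx cent1id.
(* Translation by [x] preserves the complement, where nothing commutes with [x]. *)
have leD : (2 * #|sqr1 (G :\: 'C_G[x])| <= #|'C_G[x]|)%N.
  have xD : x *: (G :\: 'C_G[x]) = G :\: 'C_G[x].
    apply/setP=> y; rewrite mem_lcoset !in_setD.
    by rewrite (groupMl _ (groupVr Gx)) (groupMl _ (groupVr Cx)).
  have := card_sqr1_cent1 Ix xD.
  have -> : sqr1 (G :\: 'C_G[x]) :&: 'C[x] = set0.
    apply/setP=> y; rewrite in_setI in_set in_setD in_setI in_set0.
    by case: (y \in G); case: (y \in 'C[x]); rewrite ?andbF.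
  by rewrite cards0 cardsD (setIidPr sC); card_lia.
have defI : #|sqr1 G| = (#|sqr1 'C_G[x]| + #|sqr1 (G :\: 'C_G[x])|)%N.
  rewrite -(cardsID 'C_G[x] (sqr1 G)); congr (_ + _)%N; apply: eq_card => y.
  - rewrite in_setI in_set [RHS]in_set in_setI.
    by case: (y \in G); rewrite //= andbC.
  - rewrite in_setD [RHS]in_set in_setD in_setI [_ \in sqr1 G]in_set.
    by case: (y \in G); rewrite ?andbT ?andbF.
(* The share of solutions is at least 4/3 - 1/2 = 5/6, above 3/4. *)
have IC : sqr1 'C_G[x] = 'C_G[x] by apply: (@sqr1_large 'C_G[x]%G); card_lia.
have /card_gt0P[y] : (0 < #|sqr1 (G :\: 'C_G[x])|)%N by rewrite IC in defI; card_lia.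
case/setIdP; rewrite in_setD => /andP[nCy Gy] y2.
have Iy : y \in sqr1 G by rewrite inE Gy.
have yC : y *: 'C_G[x] = G :\: 'C_G[x].
  have sYC : y *: 'C_G[x] \subset G :\: 'C_G[x].
    apply/subsetP=> z; rewrite mem_lcoset in_setD => Cz.
    have Gyz : y^-1 * z \in G by rewrite (subsetP sC).
    have Gz : z \in G by rewrite -(groupMl _ (groupVr Gy)).
    rewrite Gz andbT; apply: contra nCy => Cz'.
    by rewrite (groupMr _ Cz') groupV in Cz.
  apply/eqP; rewrite eqEcard sYC card_lcoset cardsD (setIidPr sC).
  by clear -LC; card_lia.
(* Every [c] in ['C_G[x]] squares to 1, so [y * c] does exactly when [c] commutes with [y]. *)
have ID : #|sqr1 (G :\: 'C_G[x])| = #|'C_('C_G[x])[y]|.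
  rewrite -[RHS](card_lcoset _ y); apply: eq_card => z.
  rewrite in_set -yC !mem_lcoset [RHS]in_setI; apply: andb_id2l.
  rewrite -{1}IC => /setIdP[_ yz2].
  by rewrite -{1}(mulKVg y z) (sqr1M Iy yz2).
have sD : 'C_('C_G[x])[y] \subset 'C_G[x] := subsetIl _ _.
rewrite IC in defI.
have ltD : (#|'C_G[x] : 'C_('C_G[x])[y]| < 4)%N.
  by apply: index_mul_bound => //; rewrite -ID; clear -nC leI LC defI; card_lia.
have LD := Lagrange sD; rewrite -ID in LD.
have D0 := indexg_gt0 'C_G[x] 'C_('C_G[x])[y].
(* Squares fall in the subgroup of index 2, whose elements square to 1. *)
have x4 : {in G, forall z, z ^+ 4 = 1}.
  move=> z Gz; have nC' : 'C_G[x] <| G by apply: index2_normal.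
  have Cz2 : z ^+ 2 \in 'C_G[x].
    have Nz : z \in 'N('C_G[x]) := subsetP (normal_norm nC') z Gz.
    rewrite coset_idr ?groupX // morphX //= -iC -card_quotient ?normal_norm //.
    by rewrite expg_cardG // mem_quotient.
  by move: Cz2; rewrite -IC => /setIdP[_ /eqP]; rewrite -expgM.
have [iD|iD|iD] : [\/ #|'C_G[x] : 'C_('C_G[x])[y]| = 1%N,
   #|'C_G[x] : 'C_('C_G[x])[y]| = 2 | #|'C_G[x] : 'C_('C_G[x])[y]| = 3].
- move: D0 ltD => /=; case: #|_ : _| => [|[|[|[|]]]] // _ _;
  by [constructor 1 | constructor 2 | constructor 3].
(* Index 1 contradicts [leD]; indices 2 and 3 give the ratios 3/4 and 2/3. *)
- by rewrite iD in LD; clear -LC LD leI defI leD nC; card_lia.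
- by constructor 3; split=> //; rewrite iD in LD; clear -LC LD leI defI leD nC; card_lia.
by constructor 2; rewrite iD in LD; clear -LC LD leI defI leD nC; card_lia.
Qed.

(** Each [x] has weight 1, or 2 if it squares to 1; the weights are grouped by the subgroup that [x]
    generates. *)
Lemma card_add_sqr1 G :
  (#|G| + #|sqr1 G| = \sum_(H in [set H in subgroups G | cyclic H])
     totient #|H| * (1 + (#|H| %| 2)))%N.
Proof.
have -> : (#|G| + #|sqr1 G| = \sum_(x in G) (1 + (x ^+ 2 == 1)%g))%N.
  by rewrite big_split /= sum1_card -big_mkcondr /= -sum1dep_card.
rewrite (partition_big (fun x => <[x]>%G)
  (mem [set H in subgroups G | cyclic H])) /=; last first.
  by move=> x Gx; rewrite !inE cycle_subG Gx cycle_cyclic.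
apply: eq_bigr => H; rewrite !inE => /andP[sHG /cyclicP[a defH]].
rewrite defH totient_gen -sum_nat_const; apply: eq_big => x.
  rewrite inE /generator -val_eqE /= -defH eq_sym andb_idl // => /eqP eH.
  by rewrite -cycle_subG -eH.
by move=> /andP[_ /eqP eH]; rewrite -order_dvdn -defH -eH.
Qed.

(** Every term of the sum is at least 2, as [totient n > 1] for [n > 2]. *)
Lemma num_cyclic_le G : (2 * num_cyclic G <= #|G| + #|sqr1 G|)%N.
Proof.
rewrite card_add_sqr1 /num_cyclic mulnC -sum_nat_const; apply: leq_sum => H _.
have := cardG_gt0 H; case: #|H| => [|[|[|n]]] // _.
by rewrite -{1}[2]muln1 leq_mul // totient_gt1.
Qed.

(** Cyclic subgroups have order 1, 2 or 4, and each of these contributes exactly 2. *)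
Lemma num_cyclic_exp4 G : {in G, forall x, x ^+ 4 = 1} ->
  (2 * num_cyclic G = #|G| + #|sqr1 G|)%N.
Proof.
move=> x4; rewrite card_add_sqr1 /num_cyclic mulnC -sum_nat_const.
apply: eq_bigr => H; rewrite !inE => /andP[sHG /cyclicP[a defH]].
have Ga : a \in G by rewrite -cycle_subG -defH.
have : #[a] %| 4 by rewrite order_dvdn x4.
rewrite defH -orderE => a4; have := @dvdn_leq #[a] 4 isT a4.
by case: #[a] a4 (order_gt0 a) => [|[|[|[|[|n]]]]].
Qed.

Lemma num_cyclic_gt0 G : (0 < num_cyclic G)%N.
Proof.
apply/card_gt0P; exists 1%G.
by rewrite !inE sub1G cyclic1.
Qed.

End SquareRootsOfOne.

Lemma ler_ratio_nat (F : numFieldType) (a b c d : nat) :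
  (0 < b)%N -> (0 < d)%N ->
  (a%:R / b%:R <= c%:R / d%:R :> F) = (a * d <= c * b)%N.
Proof.
move=> b0 d0; rewrite ler_pdivrMr ?ltr0n // mulrAC ler_pdivlMr ?ltr0n //.
by rewrite -!natrM ler_nat.
Qed.

Lemma eqr_ratio_nat (F : numFieldType) (a b c d : nat) :
  (0 < b)%N -> (0 < d)%N ->
  (a%:R / b%:R == c%:R / d%:R :> F) = (a * d == c * b)%N.
Proof.
by move=> b0 d0; rewrite eqr_div ?pnatr_eq0 -?lt0n // -!natrM eqr_nat.
Qed.

Theorem lemma4p5 (gT : finGroupType) (G : {group gT}) :
  (3%:R / 4%:R <= alpha G -> 2%:R / 3%:R <= beta G) /\
  (5%:R / 6%:R <= alpha G ->
     beta G \in [:: 4%:R / 5%:R; 6%:R / 7%:R; 1]).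
Proof.
have c0 := num_cyclic_gt0 G; have n0 := cardG_gt0 G.
have lec : (2 * num_cyclic G <= #|G| + num_sqr1 G)%N := num_cyclic_le G.
(* First claim: [i >= 2c - n] and [n <= 4c/3] give [i >= 2c/3]. *)
rewrite /alpha /beta !ler_ratio_nat //; split=> [|lea]; first lia.
have one : 1 = 1%:R / 1%:R :> rat by rewrite divr1.
rewrite !inE [X in [|| _, _ | _ == X]]one !eqr_ratio_nat //.
have := @sqr1_two_thirds _ G; rewrite -[#|sqr1 G|]/(num_sqr1 G).
move=> /(_ ltac:(lia)) [eI|eI|[eI x4]]; last 2 first.
(* With [i = 2n/3], [lec] and [lea] force [c = 5n/6], hence the ratio 4/5; the next case has
   [c = 7n/8] and ratio 6/7. *)
- lia.
- have ec : (2 * num_cyclic G = #|G| + num_sqr1 G)%N by apply: num_cyclic_exp4.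
  lia.
have ec : (2 * num_cyclic G = #|G| + num_sqr1 G)%N.
  apply: num_cyclic_exp4 => x; rewrite -eI => /setIdP[_ /eqP x2].
  by rewrite (expgM x 2 2) x2 expg1n.
have : num_sqr1 G = #|G| by rewrite -[RHS](congr1 (fun A : {set gT} => #|A|) eI).
lia.
Qed.
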